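(* Let $\varphi=\frac{1+\sqrt5}{2}$ be the golden ratio and let $\Lambda:\mathbb{R}P^1\to\mathbb R$ be the Lyapunov function of the Markov and Euclid trees. Then the Lyapunov spectrum $Spec_\Lambda=\{\Lambda(x): x\in\mathbb{R}P^1\}$ is $$Spec_\Lambda=[0,\ln\varphi].$$
   Context: $\mathbb{R}P^1=\mathbb R\cup\{\infty\}$. Let $L=\begin{pmatrix}1&1\\0&1\end{pmatrix}$, $R=\begin{pmatrix}1&0\\1&1\end{pmatrix}$. Path on the Farey tree. For real $x\ge 0$ define matrices $A_n(x)=\begin{pmatrix}a_n&b_n\\c_n&d_n\end{pmatrix}$ by $A_0(x)=I$ and $A_{n+1}(x)=A_n(x)R$ if $x<\frac{a_n+b_n}{c_n+d_n}$, $A_{n+1}(x)=A_n(x)L$ if $x>\frac{a_n+b_n}{c_n+d_n}$. (So $\frac{b_n}{d_n}\le x\le\frac{a_n}{c_n}$, with $\frac10=\infty$; the two columns are the Farey fractions adjacent to the $n$-th edge of the path $\gamma(x)$ leading to $x$.) If equality $x=\frac{a_n+b_n}{c_n+d_n}$ occurs (this happens only for positive rational $x$), the path is continued by the turns $L,R,R,R,\dots$ or by the turns $R,L,L,L,\dots$; either choice may be used. Lyapunov function. Let $w_n(x)$ be the largest entry of $A_n(x)$ (for $x\in[0,1)$ and $n\ge1$ this is $\max(c_n,d_n)$, the largest number of the triple $(u,v,w)$, $u+v=w$, met along $\gamma(x)$ on the Euclid tree formed by the denominators of the Farey fractions; shifts of the index $n$ are immaterial). For real $x\ge0$, $$\Lambda(x)=\limsup_{n\to\infty}\frac{\ln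 w_n(x)}{n}.$$ It is extended by $\Lambda(-x)=\Lambda(x)$ and $\Lambda(\infty)=0$. (In terms of Markov numbers, for $x\in[0,\frac12]$ the paper also writes $\Lambda(x)=\limsup_{n\to\infty}\frac{\ln(\ln m_n(x))}{n}$, where $m_n(x)$ is the $n$-th Markov number along the path to $x$ on the Markov tree; it treats this as an equivalent definition.) *)

(* Defs.v *)
From HB Require Import structures.
From mathcomp Require Import all_boot all_order all_algebra.
From mathcomp Require Import all_classical all_reals all_analysis.
Set Implicit Arguments.
Unset Strict Implicit.
Unset Printing Implicit Defensive.
Import Order.TTheory GRing.Theory Num.Theory.
Import numFieldNormedType.Exports.
Local Open Scope classical_set_scope.
Local Open Scope ring_scope.

Definition mx2 (a b c d : nat) : 'M[nat]_2 :=
  \matrix_(i < 2, j < 2)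
    if i == 0 then (if j == 0 then a else b) else (if j == 0 then c else d).

Definition turnL : 'M[nat]_2 := mx2 1 1 0 1.
Definition turnR : 'M[nat]_2 := mx2 1 0 1 1.

(* The columns (a, c) and (b, d) of the matrix stand for the Farey fractions
   a/c and b/d; their mediant is (a + b)/(c + d). *)
Definition mediant (R : realType) (A : 'M[nat]_2) : R :=
  (A 0%R 0%R + A 0%R 1%R)%N%:R / (A 1%R 0%R + A 1%R 1%R)%N%:R.

(* [tie x] is the turn taken when the path meets the mediant x itself
   ([true] for L, [false] for R). This happens at most once along a path: after
   the turn L (resp. R) one has b/d = x (resp. a/c = x), so every later mediant
   is > x (resp. < x) and the path goes on as R, R, R, ... (resp.
   L, L, L, ...). *)
Fixpoint farey_path (R : realType) (tie : R -> bool) (x : R) (n : nat)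
    : 'M[nat]_2 :=
  if n is m.+1 then
    let A := farey_path tie x m in
    if x < mediant R A then A *m turnR
    else if mediant R A < x then A *m turnL
    else A *m (if tie x then turnL else turnR)
  else 1%:M.

Definition largest_entry (A : 'M[nat]_2) : nat :=
  (\max_(i < 2) \max_(j < 2) A i j)%N.

(* The limsup is taken in the extended reals, so that finiteness of the
   Lyapunov function is not built into its definition. The term n = 0 of the
   sequence is 0, and is immaterial. *)
Definition lyapunov_nneg (R : realType) (tie : R -> bool) (x : R) : \bar R :=
  limn_esup
    (fun n => (ln (largest_entry (farey_path tie x n))%:R / n%:R)%:E).

(* The real projective line R U {oo}, with [None] for the point oo. *)
Definition RP1 (R : realType) : Type := option R.

Definition lyapunov (R : realType) (tie : R -> bool) (x : RP1 R) : \bar R :=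
  if x is Some y then lyapunov_nneg tie `|y| else 0%E.

Definition lyapunov_spectrum (R : realType) (tie : R -> bool)
    : set (\bar R) :=
  range (lyapunov tie).

Definition golden_ratio (R : realType) : R := (1 + Num.sqrt 5) / 2.

(* Main.v *)
(* A path is a sequence of turns, and by nested intervals every sequence with
   infinitely many turns of each kind is the path of some real number. The sum
   of all matrix entries is comparable to the largest one; each turn replaces
   one of the two column sums by their total, so entries grow at most like
   Fibonacci numbers, which gives the bound ln phi. For 0 < rho <= ln phi put
   lam = exp rho and turn greedily: change direction exactly when the entry sum
   is below lam ^ n. Repeating a turn yields only linear growth, so the sum
   never exceeds a constant times lam ^ n; and it cannot stay below lam ^ n
   forever unless the path eventually alternates, in which case it grows like
   phi ^ n. *)
Require Import Defs.
From HB Require Import structures.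
From mathcomp Require Import all_boot all_order all_algebra.
From mathcomp Require Import all_classical all_reals all_analysis.
From mathcomp Require Import lra zify.
Import Order.TTheory GRing.Theory Num.Theory.
Import numFieldNormedType.Exports.
Local Open Scope classical_set_scope.
Local Open Scope ring_scope.

(** * Limsup of logarithms under geometric bounds *)

Lemma exists_nat_gt {R : realType} (x : R) : exists n : nat, x < n%:R.
Proof.
exists (Num.bound `|x|).
exact: le_lt_trans (ler_norm _) (archi_boundP (normr_ge0 _)).
Qed.

Lemma bernoulli_le {R : realType} (x : R) n :
  1 <= x -> 1 + n%:R * (x - 1) <= x ^+ n.
Proof.
move=> x1; elim: n => [|n IH]; first by rewrite mul0r expr0 addr0.
have := exprn_ege1 n x1; rewrite -natr1 exprS; nra.
Qed.

(** The constant contributes only [ln K / n], which drops below any [e] once n exceeds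
    [ln K / e]. *)
Lemma limn_esup_ln_le {R : realType} (u : nat -> nat) (K lam : R) :
  0 < K -> 0 < lam -> (forall n, 0 < u n)%N ->
  (forall n, (u n)%:R <= K * lam ^+ n) ->
  (limn_esup (fun n => (ln (u n)%:R / n%:R)%:E) <= (ln lam)%:E)%E.
Proof.
move=> K0 lam0 u0 uK; apply/lee_addgt0Pr => e e0.
have [N NK] := exists_nat_gt (ln K / e).
(* The tail starts at [N.+1], not [N], so that its indices are nonzero and division by n is
   legitimate. *)
apply: (@le_trans _ _ (ereal_sup
    ((fun n => (ln (u n)%:R / n%:R)%:E) @` [set n | (N.+1 <= n)%N]))).
  apply: ereal_inf_lbound; exists [set n | (N.+1 <= n)%N] => //.
  by exists N.+1.
apply: ge_ereal_sup => _ [n /= Nn <-].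
have n0 : 0 < n%:R :> R by rewrite ltr0n (leq_trans _ Nn).
rewrite -EFinD lee_fin ler_pdivrMr//.
have lnu : ln (u n)%:R <= ln K + ln lam * n%:R.
  rewrite mulr_natr -lnXn// -lnM ?posrE ?exprn_gt0//.
  by rewrite ler_ln ?posrE ?ltr0n ?mulr_gt0 ?exprn_gt0.
have NnR : N%:R <= n%:R :> R by rewrite ler_nat ltnW.
have : ln K <= e * n%:R.
  by rewrite mulrC -ler_pdivrMr// (le_trans (ltW NK)).
lra.
Qed.

(** For a lower bound on a limsup, infinitely many good indices suffice: every tail contains one
    with [- ln K / n] below [e]. *)
Lemma limn_esup_ln_ge {R : realType} (u : nat -> nat) (K lam : R) :
  0 < K -> 0 < lam ->
  (forall N, exists2 n, (N <= n)%N & K * lam ^+ n <= (u n)%:R) ->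
  ((ln lam)%:E <= limn_esup (fun n => (ln (u n)%:R / n%:R)%:E))%E.
Proof.
move=> K0 lam0 uK; apply: le_ereal_inf_tmp => _ [V [N _ NV] <-].
apply/lee_addgt0Pr => e e0.
have [M MK] := exists_nat_gt (- ln K / e).
have [n] := uK (maxn N M.+1); rewrite geq_max => /andP[Nn Mn] un.
apply: (@le_trans _ _ ((ln (u n)%:R / n%:R)%:E + e%:E)%E); last first.
  by rewrite leeD2r//; apply: ereal_sup_ubound; exists n => //; exact: NV.
have n0 : 0 < n%:R :> R by rewrite ltr0n (leq_trans _ Mn).
have Klam : 0 < K * lam ^+ n by rewrite mulr_gt0 ?exprn_gt0.
rewrite -EFinD lee_fin -lerBlDr ler_pdivlMr//.
have lnu : ln K + ln lam * n%:R <= ln (u n)%:R.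
  rewrite mulr_natr -lnXn// -lnM ?posrE ?exprn_gt0//.
  by rewrite ler_ln ?posrE ?(lt_le_trans Klam).
have MnR : M%:R <= n%:R :> R by rewrite ler_nat ltnW.
have : - ln K <= e * n%:R.
  by rewrite mulrC -ler_pdivrMr// (le_trans (ltW MK)).
lra.
Qed.

(** * Paths coded by turn sequences, and their column sums *)

Definition turn (b : bool) : 'M[nat]_2 := if b then turnL else turnR.

Fixpoint turn_path (s : nat -> bool) (n : nat) : 'M[nat]_2 :=
  if n is m.+1 then turn_path s m *m turn (s m) else 1%:M.

Lemma turn_pathS s n : turn_path s n.+1 = turn_path s n *m turn (s n).
Proof. by []. Qed.

(* [turn b] replaces the column [turn_col b] by the sum of both columns. *)
Definition turn_col (b : bool) : 'I_2 := if b then (1 : 'I_2) else (0 : 'I_2).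

Definition colsum (b : bool) (A : 'M[nat]_2) : nat :=
  (A 0%R (turn_col b) + A 1%R (turn_col b))%N.

Definition entry_sum (A : 'M[nat]_2) : nat :=
  (colsum true A + colsum false A)%N.

Lemma entry_sumE b A : entry_sum A = (colsum b A + colsum (~~ b) A)%N.
Proof. by case: b => //=; rewrite addnC. Qed.

Lemma I2_cases (i : 'I_2) : i = 0 \/ i = 1.
Proof. by case: i => -[|[|//]] i2; [left|right]; exact: val_inj. Qed.

Lemma mul_turnE (A : 'M[nat]_2) b (i j : 'I_2) : (A *m turn b) i j =
  if j == turn_col b then (A i 0%R + A i 1%R)%N else A i j.
Proof.
have -> : A *m turn b = \matrix_(i, j)
    if j == turn_col b then (A i 0%R + A i 1%R)%N else A i j.
  apply/matrixP => {}i {}j; rewrite !mxE !big_ord_recl big_ord0.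
  have -> : lift ord0 ord0 = 1 :> 'I_2 by apply: val_inj.
  have -> : ord0 = 0 :> 'I_2 by apply: val_inj.
  by case: b; case: (I2_cases j) => ->; rewrite /turn !mxE /=;
    rewrite ?mulr0 ?mulr1 ?addr0 ?add0r.
by rewrite mxE.
Qed.

Lemma colsum_turn A b : colsum b (A *m turn b) = entry_sum A.
Proof. by case: b; rewrite /entry_sum /colsum !mul_turnE /=; lia. Qed.

Lemma colsum_turnN A b : colsum (~~ b) (A *m turn b) = colsum (~~ b) A.
Proof. by case: b; rewrite /colsum !mul_turnE. Qed.

Lemma entry_sum_turn A b :
  entry_sum (A *m turn b) = (entry_sum A + colsum (~~ b) A)%N.
Proof. by rewrite (entry_sumE b) colsum_turn colsum_turnN. Qed.

Lemma colsum1 b : colsum b 1%:M = 1%N.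
Proof. by case: b; rewrite /colsum !mxE. Qed.

Lemma colsum_turn_path_gt0 s n b : (0 < colsum b (turn_path s n))%N.
Proof.
elim: n b => [|n IH] b; first by rewrite colsum1.
rewrite /=; have [->|nb] := eqVneq b (s n).
  by rewrite colsum_turn /entry_sum addn_gt0 IH.
have -> : b = ~~ s n by move: nb; case: b; case: (s n).
by rewrite colsum_turnN.
Qed.

Lemma leq_largest_entry (A : 'M[nat]_2) (i j : 'I_2) :
  (A i j <= largest_entry A)%N.
Proof.
rewrite /largest_entry.
apply: leq_trans (leq_bigmax (F := fun i => \max_(j < 2) A i j)%N i).
exact: (leq_bigmax (F := fun j => A i j) j).
Qed.

Lemma largest_entry_le_entry_sum A : (largest_entry A <= entry_sum A)%N.
Proof.
apply/bigmax_leqP => i _; apply/bigmax_leqP => j _.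
rewrite /entry_sum /colsum /=.
by case: (I2_cases i) => ->; case: (I2_cases j) => ->; lia.
Qed.

Lemma entry_sum_le_largest_entry A : (entry_sum A <= 4 * largest_entry A)%N.
Proof.
rewrite /entry_sum /colsum.
by have := leq_largest_entry A; move=> H;
  have := H 0 0; have := H 0 1; have := H 1 0; have := H 1 1; rewrite /=; lia.
Qed.

Lemma largest_entry_turn_path_gt0 s n : (0 < largest_entry (turn_path s n))%N.
Proof.
have := entry_sum_le_largest_entry (turn_path s n).
have := colsum_turn_path_gt0 s n true; rewrite /entry_sum; lia.
Qed.

(** Both turns have determinant 1; the identity is free of subtraction because the entries are
    natural numbers. *)
Lemma turn_path_det s n : let A := turn_path s n in
  (A 0%R 0%R * A 1%R 1%R = (A 0%R 1%R * A 1%R 0%R).+1)%N.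
Proof.
elim: n => [|n /= IH]; first by rewrite /= !mxE.
by rewrite /= !mul_turnE; case: (s n) => /=; lia.
Qed.

(** * Nested Farey intervals and realization of turn sequences *)

Section FareyInterval.
Variable R : realType.
Implicit Types (s : nat -> bool) (x : R) (A : 'M[nat]_2).

(* Cross-multiplied form of b/d <= x <= a/c, which also makes sense for
   a/c = 1/0. *)
Definition in_interval A x :=
  (A 0%R 1%R)%:R <= x * (A 1%R 1%R)%:R /\ x * (A 1%R 0%R)%:R <= (A 0%R 0%R)%:R.

Definition in_interior A x :=
  (A 0%R 1%R)%:R < x * (A 1%R 1%R)%:R /\ x * (A 1%R 0%R)%:R < (A 0%R 0%R)%:R.

(** A turn moves one endpoint to the mediant, so the intervals are nested. *)
Lemma in_interval_turn A b x : in_interval (A *m turn b) x -> in_interval A x.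
Proof.
by rewrite /in_interval !mul_turnE; case: b => /=; rewrite !natrD !mulrDr;
  case; split; lra.
Qed.

Lemma in_interval_le s m n x : (m <= n)%N ->
  in_interval (turn_path s n) x -> in_interval (turn_path s m) x.
Proof.
move=> /subnK <-; elim: (n - m)%N => // k IH.
by rewrite addSn /= => /in_interval_turn.
Qed.

Lemma turn_path_detR s n : let A := turn_path s n in
  (A 0%R 0%R)%:R * (A 1%R 1%R)%:R = (A 0%R 1%R)%:R * (A 1%R 0%R)%:R + 1 :> R.
Proof. by rewrite /= -!natrM natr1 (turn_path_det s n). Qed.

Lemma turn_path_11_gt0 s n : (0 < turn_path s n 1%R 1%R)%N.
Proof. by have := turn_path_det s n; rewrite /=; lia. Qed.

Lemma in_interval_lower s n : let A := turn_path s n in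
  in_interval A ((A 0%R 1%R)%:R / (A 1%R 1%R)%:R).
Proof.
move=> A; have d0 : 0 < (A 1 1)%:R :> R by rewrite ltr0n turn_path_11_gt0.
have := turn_path_detR s n; rewrite -/A /= => detA.
split; first by rewrite divfK ?gt_eqF.
by rewrite mulrAC ler_pdivrMr//; lra.
Qed.

Lemma lower_lt s n x : s n -> in_interval (turn_path s n.+1) x ->
  (turn_path s n 0%R 1%R)%:R < x * (turn_path s n 1%R 1%R)%:R.
Proof.
have := turn_path_detR s n; set A := turn_path s n => /= detA sn.
rewrite /in_interval /= sn !mul_turnE /= !natrD !mulrDr => -[le1 le2].
rewrite lt_neqAle; apply/andP; split; last by lra.
apply/eqP => eq1.
(* If x were the lower endpoint, lying above the mediant would make it the upper endpoint too, and
   the determinant would vanish. *)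
have eq2 : x * (A 1 0)%:R = (A 0 0)%:R by lra.
by move: detA; rewrite -eq2 eq1; nra.
Qed.

Lemma upper_lt s n x : ~~ s n -> in_interval (turn_path s n.+1) x ->
  x * (turn_path s n 1%R 0%R)%:R < (turn_path s n 0%R 0%R)%:R.
Proof.
have := turn_path_detR s n; set A := turn_path s n => /= detA /negbTE sn.
rewrite /in_interval /= sn !mul_turnE /= !natrD !mulrDr => -[le1 le2].
rewrite lt_neqAle; apply/andP; split; last by lra.
apply/eqP => eq2.
have eq1 : x * (A 1 1)%:R = (A 0 1)%:R by lra.
by move: detA; rewrite -eq2 -eq1; nra.
Qed.

(** A run of R keeps the lower endpoint, and the next L moves it strictly while staying at most x;
    so strictness travels back along the run. The upper endpoint is symmetric. *)
Lemma in_interval_interior s x : (forall n, in_interval (turn_path s n) x) ->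
  (forall b n, exists2 m, (n <= m)%N & s m = b) ->
  forall n, in_interior (turn_path s n) x.
Proof.
move=> sx io n; split.
- have [m + sm] := io true n; move=> /subnK; move: (m - n)%N => k.
  elim: k n => [|k IH] n kn.
    by apply: lower_lt (sx _); rewrite add0n in kn; rewrite kn sm.
  have [/lower_lt|/negbTE sn] := boolP (s n); first exact.
  have := IH n.+1; rewrite addnS -addSn kn => /(_ erefl).
  by rewrite /= sn !mul_turnE.
- have [m + sm] := io false n; move=> /subnK; move: (m - n)%N => k.
  elim: k n => [|k IH] n kn.
    by apply: upper_lt (sx _); rewrite add0n in kn; rewrite kn sm.
  have [sn|/upper_lt] := boolP (s n); last exact.
  have := IH n.+1; rewrite addnS -addSn kn => /(_ erefl).
  by rewrite /= sn !mul_turnE.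
Qed.

(** The point is the supremum of the lower endpoints. One turn R makes the upper endpoint finite;
    the sequence L, L, L, ... would lead to infinity. *)
Lemma exists_in_interval s : (exists n, ~~ s n) ->
  exists x, forall n, in_interval (turn_path s n) x.
Proof.
move=> [m sm].
pose y n : R := (turn_path s n 0 1)%:R / (turn_path s n 1 1)%:R.
have yin k n : (k <= n)%N -> in_interval (turn_path s k) (y n).
  by move=> kn; apply: in_interval_le kn _; exact: in_interval_lower.
have y_nd k n : (k <= n)%N -> y k <= y n.
  by move=> /yin[+ _]; rewrite /y -ler_pdivrMr// ltr0n turn_path_11_gt0.
have y_ub k n : (0 < turn_path s k 1%R 0%R)%N ->
    y n <= (turn_path s k 0 0)%:R / (turn_path s k 1 0)%:R.
  move=> c0; rewrite ler_pdivlMr ?ltr0n//.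
  (* The lower endpoint at the common later stage still lies in the k-th interval. *)
  have yle : y n <= y (maxn k n) by apply: y_nd; exact: leq_maxr.
  have [_] := yin _ _ (leq_maxl k n).
  by apply: le_trans; rewrite ler_wpM2r.
have c0 : (0 < turn_path s m.+1 1%R 0%R)%N.
  rewrite /= (negbTE sm) mul_turnE/=.
  by rewrite addn_gt0 turn_path_11_gt0 orbT.
have ysup : has_sup (range y).
  split; first by exists (y 0%N); exists 0%N.
  exists ((turn_path s m.+1 0 0)%:R / (turn_path s m.+1 1 0)%:R) => _ [n _ <-].
  exact: y_ub.
exists (sup (range y)) => n; split.
  have d0 : 0 < (turn_path s n 1 1)%:R :> R by rewrite ltr0n turn_path_11_gt0.
  by rewrite -ler_pdivrMr//; apply: ub_le_sup; [case: ysup|exists n].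
have [->|cn0] := posnP (turn_path s n 1%R 0%R); first by rewrite mulr0.
rewrite -ler_pdivlMr ?ltr0n//; apply: ge_sup; first by case: ysup.
by move=> _ [k _ <-]; exact: y_ub.
Qed.

(** The endpoint created by turn n is the n-th mediant. As x is interior at stage n+1, it lies
    strictly on the side prescribed by [s n], and no tie occurs. *)
Lemma farey_path_realize (tie : R -> bool) s :
  (forall b n, exists2 m, (n <= m)%N & s m = b) ->
  exists2 x, 0 <= x & forall n, farey_path tie x n = turn_path s n.
Proof.
move=> io; have [|x xin] := exists_in_interval s.
  by have [m _ sm] := io false 0%N; exists m; rewrite sm.
have xint := in_interval_interior s x xin io.
exists x; first by have [+ _] := xin 0%N; rewrite /= !mxE /= mulr1.
elim=> // n IH; rewrite [LHS]/= IH [RHS]/= /mediant.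
have : 0 < (turn_path s n 1 0 + turn_path s n 1 1)%:R :> R.
  by rewrite ltr0n addn_gt0 turn_path_11_gt0 orbT.
have := xint n.+1; rewrite /in_interior /=.
case: (s n); rewrite !mul_turnE /= => -[xl xr] cd0.
  by rewrite ltNge ltr_pdivrMr// xl ler_pdivrMr// ltW.
by rewrite ltr_pdivlMr// xr.
Qed.

Lemma farey_path_turn_path (tie : R -> bool) x :
  exists s, forall n, farey_path tie x n = turn_path s n.
Proof.
exists (fun n => if x < mediant R (farey_path tie x n) then false
  else if mediant R (farey_path tie x n) < x then true else tie x).
elim=> //= n <-; do 2!case: ifP => // _.
Qed.

End FareyInterval.

(** * Fibonacci growth and the golden ratio *)

Lemma golden_ratio_sqr (R : realType) :
  golden_ratio R ^+ 2 = golden_ratio R + 1.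
Proof.
have h : Num.sqrt 5 ^+ 2 = 5 :> R by rewrite sqr_sqrtr.
by rewrite /golden_ratio; set q := Num.sqrt 5 in h *; nra.
Qed.

Lemma golden_ratio_gt1 (R : realType) : 1 < golden_ratio R.
Proof.
have : 1 < Num.sqrt 5 :> R by rewrite -[ltLHS]sqrtr1 ltr_sqrt; lra.
by rewrite /golden_ratio; lra.
Qed.

(** Both bounds are proved together: the new entry sum is the old one plus the kept column, matching
    phi^(n+3) = phi^(n+2) + phi^(n+1). *)
Lemma colsum_turn_path_le (R : realType) s n b :
  (colsum b (turn_path s n))%:R <= golden_ratio R ^+ n.+1 /\
  (entry_sum (turn_path s n))%:R <= golden_ratio R ^+ n.+2.
Proof.
have phi1 := golden_ratio_gt1 R; have phi2 := golden_ratio_sqr R.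
elim: n b => [|n IH] b.
  by rewrite /= /entry_sum !colsum1 expr1 phi2; split; lra.
have [col sum] := IH (~~ s n).
have sum' : (entry_sum (turn_path s n.+1))%:R <= golden_ratio R ^+ n.+3.
  rewrite /= entry_sum_turn natrD (exprD _ 2 n.+1) phi2 mulrDl mul1r -exprS.
  exact: lerD.
split => //=; have [->|nb] := eqVneq b (s n); first by rewrite colsum_turn.
have -> : b = ~~ s n by move: nb; case: b; case: (s n).
rewrite colsum_turnN; apply: le_trans col _.
by rewrite ler_weXn2l// ltW.
Qed.

(* Along an alternating path each new column is the sum of the last two. *)
Lemma colsum_alternating_ge (R : realType) s N :
  (forall n, (N <= n)%N -> s n.+1 = ~~ s n) ->
  forall k, let A := turn_path s (k + N).+1 in
    golden_ratio R ^+ k <= golden_ratio R * (colsum (s (k + N)%N) A)%:R /\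
    golden_ratio R ^+ k <= golden_ratio R ^+ 2 * (colsum (~~ s (k + N)%N) A)%:R.
Proof.
move=> alt; have phi1 := golden_ratio_gt1 R; have phi2 := golden_ratio_sqr R.
elim=> [|k IH] A.
  have col1 b : 1 <= (colsum b A)%:R :> R by rewrite ler1n colsum_turn_path_gt0.
  by have := col1 (s N); have := col1 (~~ s N); rewrite expr0 add0n; split; nra.
move: IH; rewrite /A addSn alt ?leq_addl// [turn_path _ (k + N).+2]/=.
rewrite [s (k + N).+1]alt ?leq_addl//.
set B := turn_path s (k + N).+1 => /= -[new old].
rewrite colsum_turn colsum_turnN negbK (entry_sumE (s (k + N)%N)) natrD exprS.
have phi0 : 0 < golden_ratio R by lra.
split; last by rewrite expr2 -mulrA ler_pM2l.
(* What remains is phi^k <= new + old. Multiplied by phi^2 = phi + 1, it is phi times the bound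
   [new] plus the bound [old]. *)
rewrite ler_pM2l// -(ler_pM2l (exprn_gt0 2 phi0)) mulrDr.
by rewrite [leLHS]mulrC {1}phi2 mulrDr mulr1 lerD// mulrC expr2 -mulrA ler_pM2l.
Qed.

(** * Growth of the greedy path of rate [lam] *)

Section Greedy.
Variables (R : realType) (lam : R).

(** The pair carries the last turn, which the xor flips when the entry sum is small. At stage 0 the
    test 2 < 1 fails, so the first turn is L. *)
Fixpoint greedy (n : nat) : bool * 'M[nat]_2 :=
  if n is m.+1 then
    let: (b, A) := greedy m in
    let b' := b (+) ((entry_sum A)%:R < lam ^+ m) in (b', A *m turn b')
  else (true, 1%:M).

Definition greedy_turn n := (greedy n.+1).1.
Local Notation P := (turn_path greedy_turn).
Local Notation size n := ((entry_sum (P n))%:R : R).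

Lemma greedyE n : (greedy n).2 = P n.
Proof.
by elim: n => // n IH; rewrite /= -IH /greedy_turn /=; case: (greedy n).
Qed.

Lemma greedy_turnS n :
  greedy_turn n.+1 = greedy_turn n (+) (size n.+1 < lam ^+ n.+1).
Proof.
rewrite -greedyE {1}/greedy_turn [greedy n.+2]/= -/(greedy n.+1).
by rewrite /greedy_turn; case: (greedy n.+1).
Qed.

(* [j] is the start of the current run of equal turns, along which the
   entry sum grows by a constant. *)
Lemma greedy_run n : 1 < lam -> exists2 j, (j <= n.+1)%N &
  size n.+1 <= (n.+2 - j)%:R * (3 * lam ^+ j) /\
  (colsum (~~ greedy_turn n) (P n.+1))%:R <= 3 * lam ^+ j.
Proof.
move=> lam1; have lamX_ge1 k := exprn_ege1 k (ltW lam1).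
elim: n => [|n [j jn [sj cj]]].
  (* The constant 3 comes from here: it is the entry sum after the first turn. *)
  exists 1%N => //; rewrite expr1 mul1r turn_pathS entry_sum_turn colsum_turnN.
  by rewrite /entry_sum !colsum1 -[(1 + 1 + 1)%N]/3%N; split; lra.
have [small|big] := boolP (size n.+1 < lam ^+ n.+1).
  (* A switch starts a new run from an entry sum below [lam ^+ n.+1], and one turn at most doubles
     it. *)
  have le2 : size n.+2 <= 3 * lam ^+ n.+2.
    have : size n.+2 <= 2 * size n.+1.
      rewrite turn_pathS entry_sum_turn natrD mulrDl mul1r lerD2l ler_nat.
      by rewrite (entry_sumE (greedy_turn n.+1)) leq_addl.
    have : lam ^+ n.+1 <= lam ^+ n.+2 by rewrite ler_weXn2l ?ltW.
    have := lamX_ge1 n.+1; lra.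
  exists n.+2 => //; split; first by rewrite subSn// subnn mul1r.
  apply: le_trans le2; rewrite ler_nat (entry_sumE (greedy_turn n.+1)).
  exact: leq_addl.
have sn : greedy_turn n.+1 = greedy_turn n.
  by rewrite greedy_turnS (negbTE big) addbF.
exists j; first exact: leqW.
rewrite turn_pathS entry_sum_turn colsum_turnN sn; split => //.
have -> : (n.+3 - j = (n.+2 - j).+1)%N by rewrite subSn// leqW.
by rewrite natrD -natr1 mulrDl mul1r lerD.
Qed.

(** The linear factor k + 1 of a run is absorbed by [lam ^+ k] through Bernoulli: (k + 1)(lam - 1)
    <= (1 + lam) lam^k. *)
Lemma greedy_size_le n : 1 < lam ->
  size n.+1 <= 3 * (1 + lam) / (lam - 1) * lam ^+ n.+1.
Proof.
move=> lam1; have lamX_ge1 k := exprn_ege1 k (ltW lam1).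
have l0 : 0 < lam - 1 by lra.
have [j jn [sj _]] := greedy_run n lam1.
rewrite mulrAC ler_pdivlMr//.
apply: (@le_trans _ _ ((n.+2 - j)%:R * (3 * lam ^+ j) * (lam - 1))).
  by rewrite ler_pM2r.
rewrite -(subnK jn) exprD; move: (n.+1 - j)%N (subnK jn) => k kE.
rewrite kE -kE -addSn addnK -natr1.
have bern := bernoulli_le lam k (ltW lam1).
have lk := lamX_ge1 k; have lj := lamX_ge1 j.
set p := lam ^+ k in bern lk *; set q := lam ^+ j in lj *.
have : (k%:R + 1) * (lam - 1) <= (1 + lam) * p by nra.
have : 0 <= q by lra.
nra.
Qed.

Lemma greedy_size_constant_run n k :
  (forall m, (n <= m)%N -> greedy_turn m.+1 = greedy_turn m) ->
  size (k + n.+1) <= (1 + k%:R) * size n.+1.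
Proof.
move=> const.
have gE i : greedy_turn (i + n) = greedy_turn n.
  by elim: i => // i IH; rewrite addSn const ?leq_addl.
have colE i : colsum (~~ greedy_turn n) (P (i + n.+1)) =
    colsum (~~ greedy_turn n) (P n.+1).
  elim: i => // i IH.
  by rewrite addSn turn_pathS -addSnnS gE addSnnS colsum_turnN IH.
elim: k => [|k IH]; first by rewrite add0n addr0 mul1r.
rewrite addSn turn_pathS entry_sum_turn -addSnnS gE addSnnS colE natrD -natr1.
have : (colsum (~~ greedy_turn n) (P n.+1))%:R <= size n.+1.
  by rewrite ler_nat (entry_sumE (greedy_turn n)) leq_addl.
lra.
Qed.

(** Without further switches the entry sum would stay above [lam ^+ m] and yet grow only
    linearly. *)
Lemma greedy_switches n : 1 < lam ->
  exists2 m, (n <= m)%N & greedy_turn m.+1 = ~~ greedy_turn m.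
Proof.
move=> lam1; apply: contrapT => noswitch.
have const m : (n <= m)%N -> greedy_turn m.+1 = greedy_turn m.
  move=> nm; apply: contrapT => ne; apply: noswitch; exists m => //.
  by move: ne; case: (greedy_turn m.+1); case: (greedy_turn m).
have big m : (n <= m)%N -> lam ^+ m.+1 <= size m.+1.
  move=> nm; rewrite leNgt; apply/negP => small.
  have := const _ nm.
  by rewrite greedy_turnS small addbT; case: (greedy_turn m).
set S := size n.+1.
have linear k : lam ^+ k <= (1 + k%:R) * S.
  apply: le_trans (greedy_size_constant_run n k const).
  rewrite addnS; apply: le_trans (big (k + n)%N (leq_addl _ _)).
  by rewrite ler_weXn2l ?ltW// -addnS leq_addr.
have l0 : 0 < lam - 1 by lra.
have S0 : 0 <= S by rewrite ler0n.
(* Bernoulli applied to each factor of lam^j lam^j gives at least j^2 (lam - 1)^2. This choice of j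
   makes that exceed 3jS, hence (1 + 2j)S as j >= 1. *)
have [j jS] := exists_nat_gt (3 * S / (lam - 1) ^+ 2).
have := linear (j + j)%N; have bj := bernoulli_le lam j (ltW lam1).
rewrite exprD natrD.
have j1 : 1 <= j%:R :> R.
  rewrite ler1n lt0n; apply/eqP => j0; move: jS; rewrite j0 ltNge.
  by rewrite divr_ge0 ?mulr_ge0 ?exprn_ge0 // ltW.
move: jS; rewrite ltr_pdivrMr ?exprn_gt0// => jS.
have : (1 + j%:R * (lam - 1)) ^+ 2 <= lam ^+ j * lam ^+ j.
  rewrite expr2 ler_pM// addr_ge0 ?mulr_ge0//; lra.
have : (j%:R * (lam - 1)) ^+ 2 <= (1 + j%:R * (lam - 1)) ^+ 2.
  by rewrite ler_sqr ?nnegrE ?addr_ge0 ?mulr_ge0//; lra.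
rewrite exprMn expr2 => h1 h2 h3.
have : j%:R * (3 * S) < j%:R * (j%:R * (lam - 1) ^+ 2).
  by rewrite ltr_pM2l//; lra.
have : (1 + (j%:R + j%:R)) * S <= j%:R * (3 * S) by nra.
lra.
Qed.

Lemma greedy_turn_io b n : 1 < lam ->
  exists2 m, (n <= m)%N & greedy_turn m = b.
Proof.
move=> lam1; have [m nm gm] := greedy_switches n lam1.
have [<-|ne] := eqVneq (greedy_turn m) b; first by exists m.
exists m.+1; first exact: leqW.
by rewrite gm; move: ne; case: b; case: (greedy_turn m).
Qed.

Lemma greedy_size_ge : 1 < lam -> lam <= golden_ratio R ->
  exists2 K, 0 < K & forall N, exists2 n, (N <= n)%N & K * lam ^+ n <= size n.
Proof.
move=> lam1 lam_phi.
have [io|/existsNP[N Nsmall]] :=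
    pselect (forall N, exists2 n, (N <= n)%N & lam ^+ n <= size n).
  by exists 1 => // N; have [n Nn ?] := io N; exists n; rewrite ?mul1r.
have small n : (N <= n)%N -> size n < lam ^+ n.
  move=> Nn; rewrite ltNge; apply/negP => big.
  by apply: Nsmall; exists n.
have alt n : (N <= n)%N -> greedy_turn n.+1 = ~~ greedy_turn n.
  by move=> Nn; rewrite greedy_turnS small ?addbT// leqW.
have phi1 := golden_ratio_gt1 R.
have phi0 : 0 < golden_ratio R by lra.
(* This absorbs the factor phi of the alternating bound and the [N.+1] stages before it takes
   effect. *)
exists (golden_ratio R * lam ^+ N.+1)^-1.
  by rewrite invr_gt0 mulr_gt0// exprn_gt0//; lra.
move=> M; exists (M + N.+1)%N; first exact: leq_addr.
rewrite mulrC ler_pdivrMr ?mulr_gt0 ?exprn_gt0//; last lra.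
rewrite exprD mulrA ler_pM2r ?exprn_gt0//; last lra.
have [+ _] := colsum_alternating_ge R greedy_turn N alt M.
rewrite -addnS => new.
apply: (@le_trans _ _ (golden_ratio R ^+ M)).
  by rewrite lerXn2r ?nnegrE//; lra.
apply: le_trans new _; rewrite mulrC ler_pM2r// ler_nat.
by rewrite (entry_sumE (greedy_turn (M + N)%N)) addnS leq_addr.
Qed.

End Greedy.

Theorem theorem1 (R : realType) (tie : R -> bool) :
  lyapunov_spectrum tie = EFin @` `[0, ln (golden_ratio R)].
Proof.
have phi1 := golden_ratio_gt1 R.
have phi0 : 0 < golden_ratio R by lra.
apply/seteqP; split => [_ [[x|] _ <-]|_ [rho /= + <-]]; rewrite /=.
- have [s sE] := farey_path_turn_path R tie `|x|.
  rewrite /lyapunov_nneg (funext sE).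
  have w0 n := largest_entry_turn_path_gt0 s n.
  have ge0 : (0 <= limn_esup (fun n =>
      (ln (largest_entry (turn_path s n))%:R / n%:R : R)%:E))%E.
    (* Entries at least 1 give a geometric lower bound of ratio 1. *)
    have -> : 0%E = (ln 1)%:E :> \bar R by rewrite ln1.
    apply: (@limn_esup_ln_ge _ _ 1) => // N.
    by exists N => //; rewrite expr1n mul1r ler1n.
  have le_phi : (limn_esup (fun n =>
      (ln (largest_entry (turn_path s n))%:R / n%:R : R)%:E)
      <= (ln (golden_ratio R))%:E)%E.
    apply: (@limn_esup_ln_le _ _ (golden_ratio R ^+ 2)) => //.
      by rewrite exprn_gt0.
    move=> n; have [_] := colsum_turn_path_le R s n true.
    rewrite -exprD; apply: le_trans.
    by rewrite ler_nat largest_entry_le_entry_sum.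
  have finE : limn_esup (fun n =>
      (ln (largest_entry (turn_path s n))%:R / n%:R : R)%:E) \is a fin_num.
    rewrite fin_numElt (lt_le_trans _ ge0) ?ltNy0//.
    by rewrite (le_lt_trans le_phi) ?ltry.
  rewrite -(fineK finE); eexists; last reflexivity.
  by rewrite /= in_itv /= -!lee_fin fineK// ge0.
- by exists 0 => //=; rewrite in_itv /= lexx ln_ge0// ltW.
rewrite in_itv /= => /andP[rho0 rho_phi].
(* The greedy path needs [lam] > 1; the value 0 is taken at infinity. *)
have [->|rho_neq0] := eqVneq rho 0; first by exists None.
have lam1 : 1 < expR rho by rewrite expR_gt1 lt_neqAle eq_sym rho_neq0.
have lam_phi : expR rho <= golden_ratio R.
  by rewrite -(@lnK R (golden_ratio R)) ?ler_expR// posrE.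
set lam := expR rho in lam1 lam_phi.
have [x x0 xE] := farey_path_realize R tie (greedy_turn R lam)
  (fun b n => greedy_turn_io R lam b n lam1).
exists (Some x) => //=; rewrite ger0_norm// /lyapunov_nneg.
rewrite (funext xE).
have -> : rho = ln lam by rewrite expRK.
have lam0 : 0 < lam by rewrite expR_gt0.
apply/le_anti/andP; split.
- have C0 : 0 < 3 * (1 + lam) / (lam - 1) by rewrite divr_gt0 ?mulr_gt0; lra.
  (* The added 2 covers n = 0, where the entry sum is 2 and [greedy_size_le] says nothing. *)
  apply: (@limn_esup_ln_le _ _ (3 * (1 + lam) / (lam - 1) + 2)) => //.
  + lra.
  + exact: largest_entry_turn_path_gt0.
  + move=> n.
    apply: (@le_trans _ _ (entry_sum (turn_path (greedy_turn R lam) n))%:R).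
      by rewrite ler_nat largest_entry_le_entry_sum.
    rewrite mulrDl; case: n => [|n].
      by rewrite /= /entry_sum !colsum1 expr0; lra.
    have := greedy_size_le R lam n lam1.
    by have := exprn_gt0 n.+1 lam0; lra.
- have [K K0 KE] := greedy_size_ge R lam lam1 lam_phi.
  (* The 4 is the cost of passing from the entry sum to the largest of four entries. *)
  apply: (@limn_esup_ln_ge _ _ (K / 4)) => //; first lra.
  move=> N; have [n Nn Kn] := KE N; exists n => //.
  have : (entry_sum (turn_path (greedy_turn R lam) n))%:R <=
      4 * (largest_entry (turn_path (greedy_turn R lam) n))%:R :> R.
    by rewrite -natrM ler_nat entry_sum_le_largest_entry.
  lra.
Qed.
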